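(* Let $q$ be a prime power, $g\ge 2$ and $s\ge 3$ integers, $V=\mathrm{GF}(q^g)^s$ regarded as a $gs$-dimensional vector space over $\mathrm{GF}(q)$, and let $\mathcal{G}$ be the Desarguesian $(g-1)$-spread of $V$, i.e. the set of all $1$-dimensional $\mathrm{GF}(q^g)$-subspaces of $V$ (each a $g$-dimensional $\mathrm{GF}(q)$-subspace). For $k\ge1$ let $\mathcal{F}_k$ be the set of fat $k$-dimensional $\mathrm{GF}(q)$-subspaces of $V$. (1) For each $k\in\{3,\dots,s-1\}$, $(V,\mathcal{G},\mathcal{F}_k)$ is a $(gs,g,k,\lambda)_q$-GDD with \[ \lambda=q^{(g-1)\left(\binom{k}{2}-1\right)}\prod_{i=2}^{k-1}\frac{q^{g(s-i)}-1}{q^{k-i}-1}. \] (2) Consider the action of $\mathrm{SL}(s,q^g)$ on $\mathcal{F}_s$ by $U\mapsto\{xA:x\in U\}$ (equivalently, of $\mathrm{SL}(s,q^g)/\mathrm{GF}(q)^*$); it has exactly $\frac{q^g-1}{q-1}$ orbits. For each $\alpha\in\{1,\dots,\frac{q^g-1}{q-1}\}$, the union $\mathcal{B}$ of any $\alpha$ of these orbits gives a $(gs,g,s,\lambda)_q$-GDD $(V,\mathcal{G},\mathcal{B})$ with \[ \lambda=\alpha\, q^{(g-1)\left(\binom{s}{2}-1\right)}\prod_{i=2}^{s-2}\frac{q^{gi}-1}{q^{i}-1}. \]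
   Context: A $\mathrm{GF}(q)$-subspace $U\le V$ is fat if $\dim_{\mathrm{GF}(q^g)}\langle U\rangle_{\mathrm{GF}(q^g)}=\dim_{\mathrm{GF}(q)}U$, i.e. some (equivalently every) $\mathrm{GF}(q)$-basis of $U$ is linearly independent over $\mathrm{GF}(q^g)$. For positive integers $v,g,k,\lambda$, a $(v,g,k,\lambda)_q$-GDD is a triple $(V,\mathcal{G},\mathcal{B})$ where $V$ is a $v$-dimensional $\mathrm{GF}(q)$-vector space; $\mathcal{G}$ is a set of $g$-dimensional subspaces of $V$ such that every $1$-dimensional subspace lies in exactly one element of $\mathcal{G}$, and $\#\mathcal{G}>1$; $\mathcal{B}$ is a set of $k$-dimensional subspaces of $V$; and every $2$-dimensional subspace of $V$ is either contained in exactly one element of $\mathcal{G}$ and in no element of $\mathcal{B}$, or contained in no element of $\mathcal{G}$ and in exactly $\lambda$ elements of $\mathcal{B}$. *)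

(* Defs.v *)
From HB Require Import structures.
From mathcomp Require Import all_boot all_order all_algebra.
Set Implicit Arguments. Unset Strict Implicit. Unset Printing Implicit Defensive.
Import GRing.Theory.
Local Open Scope ring_scope.

Section GDDdefs.
Variables (L : finFieldType) (s : nat).
Notation V := 'rV[L]_s.

Definition is_subfield (K : {set L}) : Prop :=
  [/\ (0 : L) \in K, (1 : L) \in K,
      {in K &, forall x y, x - y \in K},
      {in K &, forall x y, x * y \in K} & {in K, forall x, x^-1 \in K}].

Definition lincomb n (c : {ffun 'I_n -> L}) (b : {ffun 'I_n -> V}) : V :=
  \sum_(i < n) c i *: b i.

Definition Kspan (K : {set L}) n (b : {ffun 'I_n -> V}) : {set V} :=
  [set v | [exists c : {ffun 'I_n -> L},
              [forall i, c i \in K] && (v == lincomb c b)]].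

Definition Kfree (K : {set L}) n (b : {ffun 'I_n -> V}) : bool :=
  [forall c : {ffun 'I_n -> L},
     [forall i, c i \in K] ==> (lincomb c b == 0) ==> [forall i, c i == 0]].

Definition Lfree n (b : {ffun 'I_n -> V}) : bool :=
  [forall c : {ffun 'I_n -> L}, (lincomb c b == 0) ==> [forall i, c i == 0]].

Definition Kdim (K : {set L}) (U : {set V}) n : bool :=
  [exists b : {ffun 'I_n -> V}, Kfree K b && (U == Kspan K b)].

Definition fat (K : {set L}) (U : {set V}) n : bool :=
  [exists b : {ffun 'I_n -> V}, [&& Kfree K b, U == Kspan K b & Lfree b]].

Definition fatset (K : {set L}) k : {set {set V}} := [set U | fat K U k].

Definition desarg_spread : {set {set V}} :=
  (fun v : V => [set a *: v | a : L]) @: (~: [set (0 : V)]).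

Definition GDD (K : {set L}) (v g k lam : nat) (G B : {set {set V}}) : Prop :=
  [/\ Kdim K [set: V] v,
      (forall X, X \in G -> Kdim K X g) &
   [/\
      (forall P, Kdim K P 1 -> #|[set X in G | P \subset X]| = 1%N),
      (1 < #|G|)%N,
      (forall X, X \in B -> Kdim K X k) &
      (forall T, Kdim K T 2 ->
         (#|[set X in G | T \subset X]| = 1%N /\ #|[set X in B | T \subset X]| = 0%N)
      \/ (#|[set X in G | T \subset X]| = 0%N /\ #|[set X in B | T \subset X]| = lam))]].

Definition SLset : {set 'M[L]_s} := [set A | \det A == 1].

Definition actM (U : {set V}) (A : 'M[L]_s) : {set V} := [set x *m A | x in U].

Definition SLorbit (U : {set V}) : {set {set V}} := [set actM U A | A in SLset].

Definition SLorbits (K : {set L}) : {set {set {set V}}} := SLorbit @: fatset K s.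

End GDDdefs.

(* Main.v *)
Require Import Defs.
From HB Require Import structures.
From mathcomp Require Import all_boot all_order all_algebra.
From mathcomp Require Import finfield.
Set Implicit Arguments. Unset Strict Implicit. Unset Printing Implicit Defensive.
Import GRing.Theory Num.Theory.
Local Open Scope ring_scope.

(** Since [K] is the fixed field of [x |-> x ^+ q], a fat subspace is the set of
    [K]-combinations of the rows of an [L]-row-free matrix, and matrices over [K]
    are those fixed entrywise by this Frobenius map.  A [K]-plane that is not fat
    lies on one spread element and in no fat subspace.  For a fat plane, extending
    a basis to [k] independent vectors over [L] can be done in
    [\prod_(2 <= i < k) (q ^ (g * s) - q ^ (g * i))] ways, and each fat
    [k]-subspace above the plane arises [\prod_(2 <= i < k) (q ^ k - q ^ i)] times;
    the quotient is lambda.  For [k = s] the determinant of a basis, which is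
    well defined modulo the units of [K], separates the orbits of SL, and since
    [s >= 3] a linear map fixing the plane pointwise can have any nonzero
    determinant, so every orbit has the same number of members above the plane. *)

(** * Row-free block matrices *)

Lemma row_free_col_l (F : fieldType) m n p (A : 'M[F]_(m, p)) (B : 'M_(n, p)) :
  row_free (col_mx A B) -> row_free A.
Proof.
rewrite /row_free -addsmxE => /eqP e; rewrite eqn_leq rank_leq_row /=.
rewrite -(leq_add2r n) -[X in (X <= _)%N]e.
by rewrite (leq_trans (mxrank_adds_leqif A B)) // leq_add2l rank_leq_row.
Qed.

Lemma row_free_colA (F : fieldType) m n p r
    (A : 'M[F]_(m, r)) (B : 'M_(n, r)) (C : 'M_(p, r)) :
  row_free (col_mx A (col_mx B C)) = row_free (col_mx (col_mx A B) C).
Proof.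
rewrite /row_free -!addsmxE -(adds_eqmx (eqmx_refl A) (addsmxE B C)).
by rewrite -(adds_eqmx (addsmxE A B) (eqmx_refl C)) addsmxA addnA.
Qed.

(** * Matrices fixed entrywise by an endomorphism, their row spans and their counts *)

Section FixedMatrices.
Variables (L : finFieldType) (phi : {rmorphism L -> L}).

Definition fixmx m n : {set 'M[L]_(m, n)} := [set A | map_mx phi A == A].

Definition fixspan m s (M : 'M[L]_(m, s)) : {set 'rV[L]_s} :=
  [set c *m M | c in fixmx 1 m].

Lemma fixmxE m n (A : 'M[L]_(m, n)) : A \in fixmx m n -> map_mx phi A = A.
Proof. by rewrite inE => /eqP. Qed.

Lemma fixmxP m n (A : 'M[L]_(m, n)) :
  reflect (forall i j, phi (A i j) = A i j) (A \in fixmx m n).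
Proof.
rewrite inE; apply: (iffP eqP) => [/matrixP e i j|e]; first by have := e i j; rewrite mxE.
by apply/matrixP=> i j; rewrite mxE.
Qed.

Lemma fixmxM m n p (A : 'M[L]_(m, n)) (B : 'M[L]_(n, p)) :
  A \in fixmx m n -> B \in fixmx n p -> A *m B \in fixmx m p.
Proof. by rewrite !inE map_mxM => /eqP-> /eqP->. Qed.

Lemma fixmx_col m n p (A : 'M[L]_(m, p)) (B : 'M[L]_(n, p)) :
  (col_mx A B \in fixmx (m + n) p) = (A \in fixmx m p) && (B \in fixmx n p).
Proof.
rewrite !inE map_col_mx; apply/eqP/andP=> [/eq_col_mx[-> ->]|[/eqP-> /eqP->]] //.
Qed.

Lemma fixmx_det n (A : 'M[L]_n) : A \in fixmx n n -> phi (\det A) = \det A.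
Proof. by move/fixmxE=> {2}<-; rewrite det_map_mx. Qed.

Lemma fixmxV n (A : 'M[L]_n) : A \in fixmx n n -> invmx A \in fixmx n n.
Proof. by rewrite !inE map_invmx => /eqP->. Qed.

(* If [C *m A] and [A] are fixed, then the image of [C] under [phi] and [C] have
   the same product with [A]. *)
Lemma fixmx_mulr_free m n p (C : 'M[L]_(m, n)) (A : 'M[L]_(n, p)) :
  row_free A -> A \in fixmx n p -> C *m A \in fixmx m p -> C \in fixmx m n.
Proof.
move=> fA /fixmxE eA; rewrite !inE map_mxM eA => /eqP e.
by apply/eqP/(row_free_inj fA).
Qed.

Lemma fixspan_row m s (M : 'M[L]_(m, s)) i : row i M \in fixspan M.
Proof.
apply/imsetP; exists (delta_mx 0 i); last exact: rowE.
by rewrite inE map_delta_mx.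
Qed.

Lemma fixspanMS m n s (C : 'M[L]_(m, n)) (N : 'M[L]_(n, s)) :
  C \in fixmx m n -> fixspan (C *m N) \subset fixspan N.
Proof.
move=> fC; apply/subsetP=> _ /imsetP[c fc ->].
by rewrite mulmxA; apply/imset_f/fixmxM.
Qed.

Lemma fixspan_unitM n s (C : 'M[L]_n) (N : 'M[L]_(n, s)) :
  C \in fixmx n n -> C \in unitmx -> fixspan (C *m N) = fixspan N.
Proof.
move=> fC uC; apply/eqP; rewrite eqEsubset fixspanMS //=.
by rewrite -{1}[N](mulKmx uC) fixspanMS ?fixmxV.
Qed.

(** Expanding each row of [M] in the rows of [N] and stacking the coefficient rows gives [C];
    inclusions of spans thus become matrix factorisations. *)
Lemma fixspan_subP m n s (M : 'M[L]_(m, s)) (N : 'M[L]_(n, s)) :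
  reflect (exists2 C, C \in fixmx m n & M = C *m N)
          (fixspan M \subset fixspan N).
Proof.
apply: (iffP idP) => [sMN|[C fC ->]]; last exact: fixspanMS.
have ex i : exists2 c, c \in fixmx 1 n & row i M = c *m N.
  by apply/imsetP/(subsetP sMN)/fixspan_row.
have [c fc e] := fin_all_exists2 ex.
exists (\matrix_i c i).
  by apply/fixmxP=> i j; rewrite mxE; apply/fixmxP.
by apply/row_matrixP=> i; rewrite row_mul rowK.
Qed.

Lemma actM_fixspan m s (M : 'M[L]_(m, s)) A :
  actM (fixspan M) A = fixspan (M *m A).
Proof.
by rewrite /actM /fixspan -imset_comp; apply: eq_imset => c /=; rewrite mulmxA.
Qed.

Variable q : nat.
Hypothesis card_fix : #|[set x | phi x == x]| = q.

Lemma card_fixrow n : #|fixmx 1 n| = (q ^ n)%N.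
Proof.
rewrite -card_fix -[n in RHS]card_ord -card_ffun_on.
have inj : injective (fun f : {ffun 'I_n -> L} => \row_j f j).
  by move=> f f' /rowP e; apply/ffunP=> j; have := e j; rewrite !mxE.
rewrite -(card_imset _ inj); apply: eq_card => A; apply/fixmxP/imsetP.
  move=> fA; exists [ffun j => A 0 j]; last by apply/rowP=> j; rewrite !mxE ffunE.
  by apply/ffun_onP=> j; rewrite ffunE inE fA.
by case=> f /ffun_onP ff -> i j; rewrite !mxE; have := ff j; rewrite inE => /eqP.
Qed.

Lemma card_fix_gt1 : (1 < q)%N.
Proof.
rewrite -card_fix; apply/card_gt1P; exists 0, 1.
by split; rewrite ?inE ?rmorph0 ?rmorph1 ?eqxx // eq_sym oner_eq0.
Qed.

(** A fixed row in the [L]-row space of [A] already has fixed coordinates, by [fixmx_mulr_free]; so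
    the rows to exclude form [fixspan A], which has [q ^ r] elements. *)
Lemma card_fixrow_independent r m (A : 'M[L]_(r, m)) :
  A \in fixmx r m -> row_free A ->
  #|[set b in fixmx 1 m | row_free (col_mx A b)]| = (q ^ m - q ^ r)%N.
Proof.
move=> fA frA.
have -> : [set b in fixmx 1 m | row_free (col_mx A b)]
          = fixmx 1 m :\: fixspan A.
  apply/setP=> b; rewrite in_setD 2!inE -/(fixmx 1 m) andbC.
  have [fb|] := boolP (map_mx phi b == b); rewrite ?andbF // !andbT.
  have -> : (b \in fixspan A) = (b <= A)%MS.
    apply/imsetP/submxP=> [[c _ ->]|[c e]]; first by exists c.
    by exists c => //; apply: (fixmx_mulr_free frA) => //; rewrite -e inE.
  rewrite /row_free -addsmxE; have [sbA|nsbA] := boolP (b <= A)%MS.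
    by rewrite (addsmx_idPl sbA) (eqP frA) addn1 ltn_eqF.
  rewrite eqn_leq addsmxE rank_leq_row /= -addsmxE addn1.
  rewrite (leq_ltn_trans (eq_leq (esym (eqP frA)))) // rank_ltmx //.
  by rewrite ltmxE addsmxSl addsmx_sub submx_refl.
rewrite cardsD (setIidPr _); last first.
  by apply/subsetP=> _ /imsetP[c fc ->]; apply: fixmxM.
rewrite card_fixrow card_imset ?card_fixrow //.
exact: row_free_inj.
Qed.

(** Rows are chosen one at a time, and the number of choices for a row depends only on how many rows
    precede it. The induction moves the top row of [B] into [A]. *)
Lemma card_fixmx_extend r n m (A : 'M[L]_(r, m)) :
  A \in fixmx r m -> row_free A ->
  #|[set B in fixmx n m | row_free (col_mx A B)]|
  = (\prod_(r <= i < r + n) (q ^ m - q ^ i))%N.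
Proof.
elim: n r A => [|n IHn] r A fA frA.
  rewrite [in RHS]addn0 big_geq //; apply/eqP/cards1P; exists 0; apply/setP=> B.
  rewrite [B]flatmx0 !inE raddf0 !eqxx /row_free -addsmxE addsmx0 addn0.
  exact: frA.
rewrite [in RHS]addnS -[in RHS]addSn big_ltn ?leq_addr // -(addn1 r).
rewrite -(card_fixrow_independent fA frA).
rewrite -[RHS]sum_nat_const -sum1_card.
rewrite (reindex (fun p : 'rV_m * 'M_(n, m) => col_mx p.1 p.2)) /=; last first.
  exists (fun B : 'M_(1 + n, m) => (usubmx B, dsubmx B)) => [[b B]|B] _ /=.
    by rewrite col_mxKu col_mxKd.
  exact: vsubmxK.
(* Row-freeness of the whole stack forces that of [A] with [b], so the condition on [b] can be
   separated out. *)
have split_ext (b : 'rV_m) (B : 'M_(n, m)) :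
    (col_mx b B \in [set B in fixmx (1 + n) m | row_free (col_mx A B)])
    = (b \in [set b in fixmx 1 m | row_free (col_mx A b)])
   && (B \in [set B in fixmx n m | row_free (col_mx (col_mx A b) B)]).
  rewrite [LHS]in_set fixmx_col row_free_colA.
  rewrite [X in _ = X && _]in_set [X in _ = _ && X]in_set.
  have [/row_free_col_l->|] := boolP (row_free (col_mx (col_mx A b) B)).
    by rewrite !andbT.
  by rewrite !andbF.
rewrite (eq_bigl _ _ (fun p => split_ext p.1 p.2)).
rewrite -(pair_big_dep (fun b => b \in _)
   (fun b B => B \in [set B in fixmx n m | row_free (col_mx (col_mx A b) B)])
   (fun _ _ => 1%N)) /=.
apply: eq_bigr => b; rewrite inE => /andP[fb frb].
by rewrite sum1_card IHn // fixmx_col fA.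
Qed.
End FixedMatrices.

(** The identity fixes every matrix, so the previous count applies with [#|L|] for [q]. *)
Lemma card_row_free_extend (L : finFieldType) r n m (A : 'M[L]_(r, m)) :
  row_free A ->
  #|[set B : 'M_(n, m) | row_free (col_mx A B)]|
  = (\prod_(r <= i < r + n) (#|L| ^ m - #|L| ^ i))%N.
Proof.
move=> fA; have fixT k (B : 'M[L]_(k, m)) : B \in fixmx idfun k m by apply/fixmxP.
have cardL : #|[set x : L | idfun x == x]| = #|L|.
  by rewrite -cardsT; apply: eq_card => x; rewrite !inE eqxx.
rewrite -(card_fixmx_extend cardL n (fixT _ A) fA).
by apply: eq_card => B; rewrite [LHS]in_set [RHS]in_set fixT.
Qed.

(** * Fat subspaces and the number of them above a given one *)

Section FatSubspaces.
Variables (L : finFieldType) (phi : {rmorphism L -> L}) (K : {set L}).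
Hypothesis fixK : forall x, (x \in K) = (phi x == x).

Local Notation fixmx := (fixmx phi).
Local Notation fixspan := (fixspan phi).

Definition fixfree n s (M : 'M[L]_(n, s)) : Prop :=
  forall c, c \in fixmx 1 n -> c *m M = 0 -> c = 0.

Lemma lincombE n s (c : {ffun 'I_n -> L}) (M : 'M[L]_(n, s)) :
  lincomb c [ffun i => row i M] = (\row_i c i) *m M.
Proof. by rewrite mulmx_sum_row; apply: eq_bigr => i _; rewrite mxE ffunE. Qed.

Lemma ffun_rowK n (c : 'rV[L]_n) : \row_i [ffun j => c 0 j] i = c.
Proof. by apply/rowP=> i; rewrite mxE ffunE. Qed.

Lemma fixrowE n (c : {ffun 'I_n -> L}) :
  [forall i, c i \in K] = (\row_i c i \in fixmx 1 n).
Proof.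
apply/forallP/fixmxP => [fc i j|fc i]; last by have := fc 0 i; rewrite mxE fixK => ->.
by rewrite mxE; apply/eqP; rewrite -fixK.
Qed.

Lemma ffun_eq0 n (c : {ffun 'I_n -> L}) : [forall i, c i == 0] = (\row_i c i == 0).
Proof.
apply/forallP/eqP => [c0|/rowP c0 i]; last by have := c0 i; rewrite !mxE => ->.
by apply/rowP=> i; rewrite !mxE; apply/eqP.
Qed.

Lemma KspanE n s (M : 'M[L]_(n, s)) : Kspan K [ffun i => row i M] = fixspan M.
Proof.
apply/setP=> v; rewrite inE; apply/existsP/imsetP => [[c]|[c fc ->]].
  by rewrite fixrowE lincombE => /andP[fc /eqP->]; exists (\row_i c i).
by exists [ffun j => c 0 j]; rewrite fixrowE lincombE ffun_rowK fc eqxx.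
Qed.

Lemma KfreeP n s (M : 'M[L]_(n, s)) :
  reflect (fixfree M) (Kfree K [ffun i => row i M]).
Proof.
apply: (iffP forallP) => [h c fc cM0|h c].
  have := h [ffun j => c 0 j]; rewrite fixrowE lincombE ffun_eq0 ffun_rowK.
  by rewrite fc cM0 eqxx => /eqP.
rewrite fixrowE lincombE ffun_eq0; apply/implyP=> fc; apply/implyP=> /eqP cM0.
exact/eqP/h.
Qed.

Lemma LfreeE n s (M : 'M[L]_(n, s)) : Lfree [ffun i => row i M] = row_free M.
Proof.
apply/forallP/idP => [h|fM c]; last first.
  rewrite lincombE ffun_eq0; apply/implyP=> /eqP cM0.
  by rewrite -(mulmx_free_eq0 _ fM) cM0.
apply: inj_row_free => c cM0; have := h [ffun j => c 0 j].
by rewrite lincombE ffun_eq0 ffun_rowK cM0 eqxx => /eqP.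
Qed.

Lemma matrix_rowsK n s (b : {ffun 'I_n -> 'rV[L]_s}) :
  b = [ffun i => row i (\matrix_j b j)].
Proof. by apply/ffunP=> i; rewrite ffunE rowK. Qed.

Lemma row_free_fixfree n s (M : 'M[L]_(n, s)) : row_free M -> fixfree M.
Proof. by move=> fM c _ cM0; apply/eqP; rewrite -(mulmx_free_eq0 _ fM) cM0. Qed.

Lemma KdimP s (U : {set 'rV[L]_s}) n :
  reflect (exists2 M : 'M_(n, s), fixfree M & U = fixspan M) (Kdim K U n).
Proof.
apply: (iffP existsP) => [[b]|[M /KfreeP fM ->]].
  rewrite (matrix_rowsK b) => /andP[/KfreeP fM /eqP->].
  by exists (\matrix_i b i); rewrite ?KspanE.
by exists [ffun i => row i M]; rewrite fM KspanE /=.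
Qed.

Lemma fatP s (U : {set 'rV[L]_s}) n :
  reflect (exists2 M : 'M_(n, s), row_free M & U = fixspan M) (fat K U n).
Proof.
apply: (iffP existsP) => [[b]|[M fM ->]].
  rewrite (matrix_rowsK b) => /and3P[_ /eqP-> ]; rewrite LfreeE => fM.
  by exists (\matrix_i b i); rewrite ?KspanE.
exists [ffun i => row i M]; rewrite KspanE LfreeE fM eqxx !andbT.
exact/KfreeP/row_free_fixfree.
Qed.

Lemma fat_Kdim s (U : {set 'rV[L]_s}) n : fat K U n -> Kdim K U n.
Proof.
by case/fatP=> M /row_free_fixfree fM eU; apply/KdimP; exists M.
Qed.

Variable q : nat.
Hypothesis cardK : #|K| = q.

Let card_fix : #|[set x | phi x == x]| = q.
Proof. by rewrite -cardK; apply: eq_card => x; rewrite inE fixK. Qed.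

Lemma fixfree_inj n s (M : 'M[L]_(n, s)) : fixfree M ->
  {in fixmx 1 n &, injective (fun c => c *m M)}.
Proof.
move=> fM c d fc fd e; apply/eqP; rewrite -subr_eq0; apply/eqP/fM.
  by rewrite inE map_mxB !fixmxE.
by rewrite mulmxBl e subrr.
Qed.

Lemma card_fixspan n s (M : 'M[L]_(n, s)) : fixfree M -> #|fixspan M| = (q ^ n)%N.
Proof.
by move=> fM; rewrite card_in_imset ?(card_fixrow card_fix) //; apply: fixfree_inj.
Qed.

Lemma card_fixspan_le n s (M : 'M[L]_(n, s)) : (#|fixspan M| <= q ^ n)%N.
Proof. by rewrite -(card_fixrow card_fix) leq_imset_card. Qed.

Section Closed.
Variables (s : nat) (X : {set 'rV[L]_s}).
Hypotheses (XB : {in X &, forall u v, u - v \in X})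
  (XZ : forall a u, a \in K -> u \in X -> a *: u \in X).

(** The family grows greedily: [n] vectors span at most [q ^ n] elements, so their span cannot
    exhaust [X] when [X] has at least [q ^ n.+1]. *)
Lemma exists_fixfree n : (q ^ n <= #|X|)%N ->
  exists2 M : 'M_(n, s), fixfree M & fixspan M \subset X.
Proof.
elim: n => [|n IHn] leX.
  exists 0 => [c _ _|]; first exact: thinmx0.
  have /card_gt0P[u Xu] : (0 < #|X|)%N by rewrite (leq_trans _ leX).
  by apply/subsetP=> _ /imsetP[c _ ->]; rewrite mulmx0 -(subrr u) XB.
have q1 := card_fix_gt1 card_fix.
have [M fM sMX] := IHn (leq_trans (leq_pexp2l (ltnW q1) (leqnSn n)) leX).
have [v Xv vM] : exists2 v, v \in X & v \notin fixspan M.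
  apply/subsetPn; apply: contraL leX => /subset_leq_card leXM.
  rewrite -ltnNge (leq_ltn_trans (leq_trans leXM (card_fixspan_le M))) //.
  by rewrite ltn_exp2l.
have split_row (c : 'rV_(1 + n)) : c \in fixmx 1 (1 + n) ->
    exists a d, [/\ a \in K, d \in fixmx 1 n, c = row_mx a%:M d
                   & c *m col_mx v M = a *: v + d *m M].
  move=> /fixmxP fc; exists (lsubmx c 0 0), (rsubmx c); split.
  - by rewrite fixK mxE fc.
  - by apply/fixmxP=> i j; rewrite mxE fc.
  - by rewrite -mx11_scalar hsubmxK.
  by rewrite -{1}[c]hsubmxK mul_row_col {1}[lsubmx c]mx11_scalar mul_scalar_mx.
exists (col_mx v M) => [c /split_row[a [d [Ka fd -> ->]]]|]; last first.
  apply/subsetP=> _ /imsetP[c /split_row[a [d [Ka fd _ ->]]] ->].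
  have XdM : d *m M \in X by apply/(subsetP sMX)/imset_f.
  have X0 : 0 \in X by rewrite -(subrr v) XB.
  by rewrite -[d *m M]opprK XB ?XZ // -sub0r XB.
move=> avdM; have [a0|a0] := eqVneq a 0.
  move: avdM; rewrite a0 scale0r add0r => /(fM _ fd)->.
  by rewrite raddf0 row_mx0.
(* A nonzero coefficient [a] is invertible in [K], so the relation would express [v] through [M]. *)
case/negP: vM; apply/imsetP; exists (- a^-1 *: d).
  move: fd Ka; rewrite fixK => /fixmxP fd /eqP fa; apply/fixmxP => i j.
  by rewrite mxE rmorphM rmorphN fmorphV fa fd.
apply: (scalerI a0); rewrite -scalemxAl scalerA mulrN divff // scaleN1r.
by rewrite -(addr0_eq avdM) opprK.
Qed.

(** A [K]-free family of [n] vectors in [X] spans [q ^ n] elements, hence all of [X]; dimensions can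
    thus be read off from cardinalities. *)
Lemma Kdim_card n : #|X| = (q ^ n)%N -> Kdim K X n.
Proof.
move=> cX; have [|M fM sMX] := @exists_fixfree n; first by rewrite cX.
apply/KdimP; exists M => //; apply/esym/eqP.
by rewrite eqEcard sMX card_fixspan // cX leqnn.
Qed.
End Closed.

(** In coordinates with respect to [N], [M] becomes a fixed matrix [C], and the admissible [B]
    become the fixed [D] completing [C] to an invertible matrix; an invertible fixed factor keeps
    the span. *)
Lemma card_basis_extensions r n s (M : 'M[L]_(r, s)) (N : 'M[L]_(r + n, s)) :
  row_free M -> row_free N -> fixspan M \subset fixspan N ->
  #|[set B : 'M_(n, s) | row_free (col_mx M B) & fixspan (col_mx M B) == fixspan N]|
  = (\prod_(r <= i < r + n) (q ^ (r + n) - q ^ i))%N.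
Proof.
move=> fM fN /fixspan_subP[C fC eM].
have frC : row_free C.
  by apply: inj_row_free => c c0; apply/eqP; rewrite -(mulmx_free_eq0 c fM) eM mulmxA c0 mul0mx.
rewrite -(card_fixmx_extend card_fix _ fC frC).
have injN : injective (fun D : 'M_(n, r + n) => D *m N) by apply: row_free_inj.
rewrite -(card_imset _ injN); apply: eq_card => B.
have colN (D : 'M_(n, r + n)) : col_mx M (D *m N) = col_mx C D *m N.
  by rewrite mul_col_mx -eM.
rewrite inE; apply/andP/imsetP => [[fMB /eqP eMB]|[D]].
  have /fixspan_subP[D fD eD] : fixspan (col_mx M B) \subset fixspan N.
    by rewrite eMB.
  move: eD fD; rewrite -[D]vsubmxK fixmx_col mul_col_mx => /eq_col_mx[eM' eB] /andP[_ fD].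
  exists (dsubmx D) => //; rewrite inE fD.
  move: fMB; rewrite eB colN /row_free => /eqP e; rewrite eqn_leq rank_leq_row.
  by rewrite -[X in (X <= _)%N]e mxrankM_maxl.
rewrite inE => /andP[fD fCD] ->; rewrite colN; split.
  by rewrite /row_free mxrankMfree.
rewrite fixspan_unitM ?fixmx_col ?fC //; by rewrite -row_free_unit.
Qed.

(** Double counting: the [B] that extend [M] to a row-free matrix are sorted by the span of
    [col_mx M B], and all fibres have the same size. *)
Lemma card_fat_supersets r n s (M : 'M[L]_(r, s)) : row_free M ->
  (#|[set U in fatset s K (r + n) | fixspan M \subset U]|
   * \prod_(r <= i < r + n) (q ^ (r + n) - q ^ i)
   = \prod_(r <= i < r + n) (#|L| ^ s - #|L| ^ i))%N.
Proof.
move=> fM.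
rewrite -(card_row_free_extend n fM) -sum_nat_const -[RHS]sum1_card.
rewrite (partition_big (fun B : 'M_(n, s) => fixspan (col_mx M B))
  (mem [set U in fatset s K (r + n) | fixspan M \subset U])) /=; last first.
  move=> B; rewrite !inE => fMB; apply/andP; split.
    by apply/fatP; exists (col_mx M B).
  apply/fixspan_subP; exists (row_mx 1%:M 0).
    by rewrite inE map_row_mx map_mx1 map_mx0.
  by rewrite mul_row_col mul1mx mul0mx addr0.
apply: eq_bigr => U; rewrite !inE => /andP[/fatP[N fN ->] sMN].
rewrite -(card_basis_extensions fM fN sMN) sum1_card; apply: eq_card => B.
by rewrite [LHS]in_set [RHS]unfold_in in_set.
Qed.
End FatSubspaces.

(** * The Desarguesian spread and the design axioms *)

Section FatDesigns.
Variables (L : finFieldType) (phi : {rmorphism L -> L}) (K : {set L}).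
Hypothesis fixK : forall x, (x \in K) = (phi x == x).
Variables (q g : nat).
Hypotheses (cardK : #|K| = q) (cardL : #|L| = (q ^ g)%N).

Local Notation fixmx := (fixmx phi).
Local Notation fixspan := (fixspan phi).

Let card_fix : #|[set x | phi x == x]| = q.
Proof. by rewrite -cardK; apply: eq_card => x; rewrite inE fixK. Qed.

Lemma spread_lineE s (v : 'rV[L]_s) : [set a *: v | a : L] = [set u | (u <= v)%MS].
Proof.
apply/setP=> u; rewrite inE; apply/imsetP/sub_rVP => [[a _ ->]|[a ->]]; exists a => //.
Qed.

Lemma spreadP s (X : {set 'rV[L]_s}) :
  reflect (exists2 v : 'rV_s, v != 0 & X = [set u | (u <= v)%MS]) (X \in desarg_spread L s).
Proof.
apply: (iffP imsetP) => [[v]|[v v0 ->]].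
  by rewrite !inE spread_lineE => v0 ->; exists v.
by exists v; rewrite ?spread_lineE // !inE.
Qed.

Lemma spread_unique s (X : {set 'rV[L]_s}) u : X \in desarg_spread L s ->
  u != 0 -> u \in X -> X = [set w | (w <= u)%MS].
Proof.
case/spreadP=> v _ -> u0; rewrite inE => /sub_rVP[a eu].
have a0 : a != 0 by apply: contraNneq u0 => a0; rewrite eu a0 scale0r.
by apply/setP=> w; rewrite !inE eu (eqmx_scale _ a0).
Qed.

(** Any spread element containing [T] contains [u], hence is the [L]-line of [u]. *)
Lemma card_spread_above s (T : {set 'rV[L]_s}) u : u != 0 -> u \in T ->
  T \subset [set w | (w <= u)%MS] ->
  #|[set X in desarg_spread L s | T \subset X]| = 1%N.
Proof.
move=> u0 Tu sTu; apply/eqP/cards1P; exists [set w | (w <= u)%MS].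
apply/setP=> X; rewrite in_set in_set1; apply/andP/eqP => [[GX /subsetP sTX]|->].
  exact: (spread_unique GX u0 (sTX _ Tu)).
by split=> //; apply/spreadP; exists u.
Qed.

Lemma spread_Kdim s (X : {set 'rV[L]_s}) : X \in desarg_spread L s -> Kdim K X g.
Proof.
case/spreadP=> v v0 ->; apply: (Kdim_card fixK cardK).
- move=> u w; rewrite !inE => uv wv.
  by rewrite addmx_sub // eqmx_opp.
- by move=> a u _; rewrite !inE; apply: scalemx_sub.
rewrite -cardL -spread_lineE card_imset //.
by move=> a b /eqP; rewrite -subr_eq0 -scalerBl scaler_eq0 (negPf v0) orbF subr_eq0 => /eqP.
Qed.

Lemma Kdim_setT s : Kdim K [set: 'rV[L]_s] (g * s).
Proof.
apply: (Kdim_card fixK cardK) => [u v|a u|]; rewrite ?inE //.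
by rewrite cardsT card_mx mul1n cardL -expnM.
Qed.

Lemma fixfree_row_neq0 n s (M : 'M[L]_(n, s)) i : fixfree phi M -> row i M != 0.
Proof.
move=> fM; apply: contraTneq (oner_neq0 L) => ri0; rewrite negbK.
(* If row [i] vanished, the unit row [delta_mx 0 i] would be a nontrivial fixed relation. *)
have e0 : delta_mx 0 i = 0 :> 'rV[L]_n by apply: fM; rewrite -?rowE // inE map_delta_mx.
by have /eqP := congr1 (fun c : 'rV_n => c 0 i) e0; rewrite !mxE !eqxx.
Qed.

Lemma card_spread_gt1 s : (1 < s)%N -> (1 < #|desarg_spread L s|)%N.
Proof.
case: s => [|[|s]] // _.
have dn0 i : delta_mx 0 i != 0 :> 'rV[L]_s.+2.
  by apply/eqP=> /matrixP/(_ 0 i)/eqP; rewrite !mxE !eqxx oner_eq0.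
apply/card_gt1P.
exists [set w | (w <= (delta_mx 0 0 : 'rV[L]_s.+2))%MS],
       [set w | (w <= (delta_mx 0 1 : 'rV[L]_s.+2))%MS]; split.
- by apply/spreadP; exists (delta_mx 0 0).
- by apply/spreadP; exists (delta_mx 0 1).
apply/eqP=> /setP/(_ (delta_mx 0 0)); rewrite !inE submx_refl => /esym/sub_rVP[a].
by move=> /matrixP/(_ 0 0)/eqP; rewrite !mxE /= mulr0 oner_eq0.
Qed.

Lemma fixspan_sub_line n s (M : 'M[L]_(n, s)) w :
  (fixspan M \subset [set u | (u <= w)%MS]) = (M <= (w : 'rV_s))%MS.
Proof.
apply/subsetP/row_subP => [h i|h _ /imsetP[c _ ->]].
  by have := h _ (fixspan_row phi M i); rewrite inE.
by rewrite inE; apply: (submx_trans (submxMl _ _)); apply/row_subP.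
Qed.

(* Row-freeness over the fixed field implies row-freeness over [L] for a fixed
   matrix [C], because [kermx C] is again fixed. *)
Lemma fixfree_sub_fat m n s (M : 'M[L]_(m, s)) (N : 'M_(n, s)) :
  fixfree phi M -> row_free N -> fixspan M \subset fixspan N -> row_free M.
Proof.
move=> fM fN /fixspan_subP[C fC eM].
suff frC : row_free C by rewrite eM /row_free mxrankMfree.
rewrite -kermx_eq0; apply/eqP/row_matrixP=> i; rewrite row0; apply: fM.
  by rewrite inE map_row map_kermx (fixmxE fC).
by rewrite eM mulmxA -row_mul mulmx_ker row0 mul0mx.
Qed.

(** Reduces the design axioms to one count over fat planes: a row-free basis has rank too large for
    an [L]-line, and a basis that is not row-free spans no part of a fat subspace. *)
Lemma GDD_of_fat s k lam (B : {set {set 'rV[L]_s}}) : (1 < s)%N ->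
  B \subset fatset s K k ->
  (forall M : 'M[L]_(2, s), row_free M ->
     #|[set X in B | fixspan M \subset X]| = lam) ->
  GDD K (g * s) g k lam (desarg_spread L s) B.
Proof.
move=> s1 /subsetP sBF cB.
have fatB X : X \in B -> fat K X k by move/sBF; rewrite inE.
split; [exact: Kdim_setT | exact: spread_Kdim |].
split.
- move=> P /(KdimP fixK)[M fM ->].
  apply: (@card_spread_above _ _ (row 0 M)).
  + exact: fixfree_row_neq0.
  + exact: fixspan_row.
  rewrite fixspan_sub_line; apply/row_subP=> i; by rewrite ord1.
- exact: card_spread_gt1.
- by move=> X /fatB; apply: (fat_Kdim fixK).
move=> T /(KdimP fixK)[M fM ->]; have [frM|nfrM] := boolP (row_free M).
  right; split; last exact: cB.
  apply/eqP; rewrite cards_eq0 -subset0; apply/subsetP=> X.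
  rewrite in_set => /andP[/spreadP[w _ ->]]; rewrite fixspan_sub_line => /mxrankS.
  rewrite (eqP frM) => /leq_trans/(_ (rank_leq_row w)); by [].
left; split; last first.
  apply/eqP; rewrite cards_eq0 -subset0; apply/subsetP=> X.
  rewrite in_set => /andP[/fatB/(fatP fixK)[N fN ->]].
  by move/(fixfree_sub_fat fM fN); rewrite (negPf nfrM).
have u0 := fixfree_row_neq0 0 fM.
apply: (card_spread_above u0); first exact: fixspan_row.
(* Row 0 is nonzero and the [L]-rank of [M] is below 2, so row 0 alone spans [M] over [L]. *)
rewrite fixspan_sub_line -(mxrank_leqif_sup (row_sub 0 M)) eqn_leq mxrankS ?row_sub //=.
rewrite rank_rV u0 -ltnS ltn_neqAle rank_leq_row andbT.
exact: nfrM.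
Qed.
End FatDesigns.

(** * Orbits of SL as determinant classes *)

Section Orbits.
Variables (L : finFieldType) (phi : {rmorphism L -> L}) (K : {set L}).
Hypothesis fixK : forall x, (x \in K) = (phi x == x).

Local Notation fixmx := (fixmx phi).
Local Notation fixspan := (fixspan phi).

Definition dilation n (a : L) : 'M[L]_n.+1 :=
  diag_mx (\row_i if i == ord0 then a else 1).

Lemma det_dilation n a : \det (dilation n a) = a.
Proof.
rewrite det_diag big_ord_recl mxE eqxx big1 ?mulr1 // => i _.
by rewrite mxE eq_sym (negPf (neq_lift _ _)).
Qed.

Lemma dilation_fix n a : a \in K -> dilation n a \in fixmx n.+1 n.+1.
Proof.
rewrite fixK => /eqP fa; apply/fixmxP=> i j; rewrite !mxE rmorphMn.
by case: ifP => _ /=; rewrite ?fa ?rmorph1.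
Qed.

Section Square.
Variable s : nat.

(** For nonzero [d] this is an SL-orbit, labelled by a determinant so that orbits can be compared
    and counted. *)
Definition det_class (d : L) : {set {set 'rV[L]_s}} :=
  [set fixspan N | N in [set N : 'M_s | \det N == d]].

Lemma det_classP d U :
  reflect (exists2 N : 'M_s, \det N = d & U = fixspan N) (U \in det_class d).
Proof.
apply: (iffP imsetP) => [[N]|[N dN ->]]; first by rewrite inE => /eqP; exists N.
by exists N; rewrite // inE dN.
Qed.

Lemma row_free_det (N : 'M[L]_s) : row_free N = (\det N != 0).
Proof. by rewrite row_free_unit unitmxE unitfE. Qed.

(** If [N] has the determinant of [M], the factor [invmx M *m N] carrying [M] to [N] lies in SL. *)
Lemma SLorbit_fixspan (M : 'M[L]_s) : \det M != 0 ->
  SLorbit (fixspan M) = det_class (\det M).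
Proof.
move=> dM; have uM : M \in unitmx by rewrite unitmxE unitfE.
apply/setP=> U; apply/imsetP/det_classP => [[A]|[N dN ->]].
  rewrite inE => /eqP dA ->; exists (M *m A); first by rewrite det_mulmx dA mulr1.
  exact: actM_fixspan.
exists (invmx M *m N); first by rewrite inE det_mulmx det_inv dN mulVf.
by rewrite actM_fixspan mulKVmx.
Qed.

Lemma det_class_fat d : d != 0 -> det_class d \subset fatset s K s.
Proof.
move=> d0; apply/subsetP=> _ /det_classP[N dN ->]; rewrite inE.
by apply/(fatP fixK); exists N; rewrite // row_free_det dN.
Qed.

Lemma fixspan_eq_det (N N' : 'M[L]_s) : \det N != 0 ->
  fixspan N = fixspan N' -> \det N' / \det N \in K.
Proof.
move=> dN e; have /fixspan_subP[C fC ->] : fixspan N' \subset fixspan N by rewrite e.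
by rewrite det_mulmx mulfK // fixK (fixmx_det fC).
Qed.

End Square.

(** Two bases of one subspace differ by a matrix over [K], whose determinant lies in [K].
    Conversely, a left dilation by a nonzero element of [K] rescales the determinant and keeps the
    span. *)
Lemma det_class_eq s d d' : d != 0 -> d' != 0 ->
  (det_class s.+1 d == det_class s.+1 d') = (d' / d \in K).
Proof.
move=> d0 d'0; apply/eqP/idP => [e|Kd].
  have : fixspan (dilation s d) \in det_class s.+1 d'.
    by rewrite -e; apply/det_classP; exists (dilation s d); rewrite ?det_dilation.
  case/det_classP=> N dN /fixspan_eq_det; rewrite det_dilation dN; exact.
have sub e e' : e != 0 -> e' != 0 -> e' / e \in K ->
    det_class s.+1 e \subset det_class s.+1 e'.
  move=> e0 e'0 Ke; apply/subsetP=> _ /det_classP[N dN ->].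
  apply/det_classP; exists (dilation s (e' / e) *m N).
    by rewrite det_mulmx det_dilation dN divfK.
  rewrite fixspan_unitM ?dilation_fix //.
  by rewrite unitmxE det_dilation unitfE mulf_neq0 ?invr_eq0.
apply/eqP; rewrite eqEsubset !sub //.
by move: Kd; rewrite !fixK -[d / d']invf_div fmorphV => /eqP->.
Qed.

Lemma SLorbitsE s : SLorbits s.+1 K = det_class s.+1 @: [set~ 0].
Proof.
apply/setP=> X; apply/imsetP/imsetP => [[U]|[d]].
  rewrite inE => /(fatP fixK)[M fM ->] ->.
  by exists (\det M); rewrite ?inE ?SLorbit_fixspan -?row_free_det.
rewrite !inE => d0 ->; exists (fixspan (dilation s d)).
  rewrite inE; apply/(fatP fixK); exists (dilation s d) => //.
  by rewrite row_free_det det_dilation.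
by rewrite SLorbit_fixspan det_dilation.
Qed.

(** The labels [d] of one orbit form a coset of the units of [K], so [det_class] has fibres of size
    [#|K|.-1] on the nonzero elements of [L]. *)
Lemma card_SLorbits s : (#|SLorbits s.+1 K| * #|K|.-1 = #|L|.-1)%N.
Proof.
rewrite SLorbitsE -[in RHS](cardsC1 (0 : L)) -sum_nat_const -[RHS]sum1_card.
rewrite (partition_big_imset (det_class s.+1)) /=.
apply: eq_bigr => X /imsetP[d d0 ->]; move: d0; rewrite !inE => d0.
have K0 : 0 \in K by rewrite fixK rmorph0.
rewrite (cardsD1 0 K) K0 /=.
have inj : injective ( *%R d) by apply: mulfI.
rewrite sum1dep_card -(card_imset _ inj); apply: eq_card => e.
rewrite [RHS]inE !inE; apply/imsetP/andP => [[a]|[e0]].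
  rewrite !inE => /andP[a0 Ka] ->; split; first by rewrite mulf_neq0.
  by rewrite eq_sym det_class_eq ?mulf_neq0 // mulrC mulKf.
rewrite eq_sym det_class_eq // => Ke; exists (e / d); last by rewrite mulrC divfK.
by rewrite !inE Ke mulf_neq0 ?invr_eq0.
Qed.

Lemma trivIset_SLorbits s : trivIset (SLorbits s.+1 K).
Proof.
apply/trivIsetP=> X Y; rewrite SLorbitsE => /imsetP[d d0 ->] /imsetP[e e0 ->].
move: d0 e0; rewrite !inE => d0 e0; apply: contraR => /pred0Pn[U /andP[]] /=.
case/det_classP=> N dN -> /det_classP[N' dN' eN]; rewrite det_class_eq //.
by rewrite -dN -dN' fixspan_eq_det // dN.
Qed.

Lemma SLorbits_fat s (O : {set {set {set 'rV[L]_s.+1}}}) :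
  O \subset SLorbits s.+1 K -> \bigcup_(X in O) X \subset fatset s.+1 K s.+1.
Proof.
move=> sO; apply/bigcupsP=> X /(subsetP sO); rewrite SLorbitsE => /imsetP[d].
by rewrite !inE => d0 ->; apply: det_class_fat.
Qed.

Lemma cover_SLorbits s : cover (SLorbits s.+1 K) = fatset s.+1 K s.+1.
Proof.
apply/eqP; rewrite eqEsubset SLorbits_fat //=; apply/subsetP=> U fU.
apply/bigcupP; exists (SLorbit U); first exact: imset_f.
apply/imsetP; exists 1%:M; first by rewrite inE det1.
by rewrite /actM (eq_imset _ (@mulmx1 _ _ _)) imset_id.
Qed.

Section FixedPlane.
Variables (n : nat) (M : 'M[L]_(2, 2 + n.+1)).
Hypothesis fM : row_free M.

Let above d := [set U in det_class (2 + n.+1) d | fixspan M \subset U].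

(* Completing [M] to an invertible [W], the conjugate by [W] of a dilation of a
   vector outside the plane fixes [M] and has determinant [d' / d]. *)
Lemma leq_card_above d d' : d != 0 -> d' != 0 -> (#|above d| <= #|above d'|)%N.
Proof.
move=> d0 d'0.
have [B fMB] : exists B : 'M_(n.+1, 2 + n.+1), row_free (col_mx M B).
  pose E := [set B : 'M_(n.+1, 2 + n.+1) | row_free (col_mx M B)].
  have /card_gt0P[B] : (0 < #|E|)%N.
    rewrite card_row_free_extend // big_seq prodn_cond_gt0 // => i; rewrite mem_index_iota subn_gt0 => /andP[_ ?].
    rewrite ltn_exp2l //; apply/card_gt1P; exists (0 : L), 1.
    by rewrite eq_sym oner_eq0.
  by rewrite inE; exists B.
set W := col_mx M B in fMB.
have uW : W \in unitmx by rewrite -row_free_unit.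
have [A [dA MA]] : exists A : 'M[L]_(2 + n.+1), \det A = d' / d /\ M *m A = M.
  pose D : 'M_(2 + n.+1) := block_mx 1%:M 0 0 (dilation n (d' / d)).
  exists (invmx W *m D *m W); split.
    rewrite !det_mulmx det_inv mulrAC mulVf -?row_free_det // mul1r.
    by rewrite det_ublock det1 mul1r det_dilation.
  (* The upper block of this identity reads [M *m A = M]. *)
  have : W *m (invmx W *m D *m W) = D *m W by rewrite !mulmxA mulmxV // mul1mx.
  rewrite {1 3}/W mul_col_mx mul_block_col => /eq_col_mx[-> _].
  by rewrite mul1mx mul0mx addr0.
have uA : A \in unitmx by rewrite unitmxE dA unitfE mulf_neq0 ?invr_eq0.
have inj : injective (fun U => actM U A) by exact: imset_inj (can_inj (mulmxK uA)).
rewrite -(card_imset _ inj); apply/subset_leq_card/subsetP => V /imsetP[U aU ->].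
move: aU; rewrite inE => /andP[/det_classP[N dN ->] sMN].
rewrite inE actM_fixspan.
apply/andP; split.
  by apply/det_classP; exists (N *m A); rewrite // det_mulmx dN dA mulrC divfK.
by rewrite -MA -!actM_fixspan imsetS.
Qed.

(** By [leq_card_above] in both directions, all orbits have equally many members above the plane. As
    orbits are disjoint, the count for a union is proportional to its number of orbits; all orbits
    together give the fat subspaces. *)
Lemma card_SLorbits_above (O : {set {set {set 'rV[L]_(2 + n.+1)}}}) :
  O \subset SLorbits (2 + n.+1) K ->
  (#|[set U in \bigcup_(X in O) X | fixspan M \subset U]| * #|SLorbits (2 + n.+1) K|
  = #|O| * #|[set U in fatset (2 + n.+1) K (2 + n.+1) | fixspan M \subset U]|)%N.
Proof.
rewrite -cover_SLorbits.
have count (P : {set {set {set 'rV[L]_(2 + n.+1)}}}) :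
    P \subset SLorbits (2 + n.+1) K ->
    #|[set U in cover P | fixspan M \subset U]| = (#|P| * #|above 1%R|)%N.
  move=> sP; rewrite -sum1dep_card big_trivIset_cond; last first.
    exact: trivIsetS sP (trivIset_SLorbits _).
  rewrite -sum_nat_const; apply: eq_bigr => X /(subsetP sP).
  rewrite SLorbitsE => /imsetP[d]; rewrite !inE => d0 ->; rewrite sum1dep_card.
  by apply/eqP; rewrite eqn_leq !leq_card_above ?oner_neq0.
by move=> sO; rewrite (count _ sO) count // mulnAC mulnA.
Qed.
End FixedPlane.
End Orbits.

(** * A finite subfield as the fixed field of a power map *)

Section PowerMap.
Variables (R : comNzRingType) (q : nat).
(* The unused argument lets the morphism instances depend on the
   characteristic. *)
Definition pow_map of [pchar R].-nat q := fun x : R => x ^+ q.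
Hypothesis charq : [pchar R].-nat q.

Lemma pow_map_is_zmod_morphism : zmod_morphism (pow_map charq).
Proof.
move=> x y; apply: (addIr (y ^+ q)).
by rewrite /pow_map -exprDn_pchar // !subrK.
Qed.

Lemma pow_map_is_monoid_morphism : monoid_morphism (pow_map charq).
Proof. by split=> [|x y]; rewrite /pow_map ?expr1n ?exprMn. Qed.

HB.instance Definition _ :=
  GRing.isZmodMorphism.Build R R (pow_map charq) pow_map_is_zmod_morphism.
HB.instance Definition _ :=
  GRing.isMonoidMorphism.Build R R (pow_map charq) pow_map_is_monoid_morphism.
End PowerMap.

(** Multiplication by a nonzero [x] permutes the nonzero elements of [K]; comparing their products
    gives [x ^+ #|K|.-1 = 1]. *)
Lemma subfield_expr_card (L : finFieldType) (K : {set L}) x :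
  is_subfield K -> x \in K -> x ^+ #|K| = x.
Proof.
case=> K0 K1 _ KM KV Kx; have [->|x0] := eqVneq x 0.
  by rewrite (cardsD1 0 K) K0 expr0n.
have e : \prod_(y in K :\ 0) y = \prod_(y in K :\ 0) (x * y).
  rewrite [LHS](reindex_inj (mulfI x0)); apply: eq_bigl => y.
  rewrite !inE mulf_eq0 negb_or x0 /=; congr (_ && _); apply/idP/idP => Ky.
    by rewrite -(mulKf x0 y) KM ?KV.
  exact: KM.
rewrite (cardsD1 0 K) K0 exprS.
rewrite big_split prodr_const /= in e.
have p0 : \prod_(y in K :\ 0) y != 0.
  by apply/prodf_neq0 => y; rewrite !inE => /andP[].
by rewrite -[X in _ * X](mulfK p0) -e divff ?mulr1.
Qed.

(** The elements of [K] are roots of ['X^(p ^ e) - 'X], which has at most [p ^ e] roots in [L]; so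
    [K] is the whole root set. Characteristic [p] makes the power map a morphism. *)
Lemma subfield_fixed (L : finFieldType) (K : {set L}) (p e g : nat) :
  prime p -> (0 < e)%N -> is_subfield K -> #|K| = (p ^ e)%N ->
  #|L| = ((p ^ e) ^ g)%N ->
  exists phi : {rmorphism L -> L}, forall x, (x \in K) = (phi x == x).
Proof.
move=> pp e0 sK cK cL; rewrite -expnM in cL.
have chp := card_finPcharP cL pp.
have chq : [pchar L].-nat (p ^ e)%N.
  by rewrite (eq_pnat _ (pcharf_eq chp)) pnatX pnat_id.
exists (pow_map chq).
suff eK : K = [set x | x ^+ (p ^ e) == x] by move=> x; rewrite {1}eK inE.
apply/eqP; rewrite eqEcard; apply/andP; split.
  by apply/subsetP=> x Kx; rewrite inE -cK subfield_expr_card.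
rewrite cK.
have q1 : (1 < p ^ e)%N by rewrite -(exp1n e) ltn_exp2r // prime_gt1.
pose P : {poly L} := 'X^(p ^ e) - 'X.
have sP : size P = (p ^ e).+1.
  by rewrite size_polyDl ?size_polyXn // size_polyN size_polyX ltnS.
have P0 : P != 0 by rewrite -size_poly_eq0 sP.
rewrite -ltnS -sP cardE max_poly_roots ?enum_uniq //.
by apply/allP=> x; rewrite mem_enum inE /root !hornerE subr_eq0.
Qed.

(** * Closed form of lambda *)

Lemma sum_nat_from2 k : (2 <= k)%N -> (\sum_(2 <= i < k) i = 'C(k, 2) - 1)%N.
Proof.
move=> k2; rewrite -bin2_sum.
by rewrite [in RHS]big_ltn ?(ltnW k2) // [in RHS]big_ltn // add0n addKn.
Qed.

(** Extracting [q ^ i] below and [q ^ (g * i)] above from the factors at [i] leaves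
    [q ^ ((g - 1) * i)]; these powers multiply to the one in front. *)
Lemma fat_quotientE (q g s k lam : nat) : (1 < q)%N -> (0 < g)%N ->
  (2 <= k)%N -> (k <= s)%N ->
  (lam * \prod_(2 <= i < k) (q ^ k - q ^ i)
   = \prod_(2 <= i < k) ((q ^ g) ^ s - (q ^ g) ^ i))%N ->
  lam%:R = q%:R ^+ ((g - 1) * ('C(k, 2) - 1))
    * \prod_(2 <= i < k) ((q%:R ^+ (g * (s - i)) - 1) / (q%:R ^+ (k - i) - 1)) :> rat.
Proof.
move=> q1 g0 k2 ks /(congr1 (fun m => m%:R : rat)).
rewrite natrM !natr_prod => e.
have q0 : (q%:R : rat) != 0 by rewrite pnatr_eq0 -lt0n ltnW.
have B0 i : (2 <= i < k)%N -> (q ^ k - q ^ i)%:R != 0 :> rat.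
  by case/andP=> _ ik; rewrite pnatr_eq0 subn_eq0 -ltnNge ltn_exp2l.
have P0 : \prod_(2 <= i < k) (q ^ k - q ^ i)%:R != 0 :> rat.
  by rewrite prodf_seq_neq0; apply/allP => i; rewrite mem_index_iota; apply: B0.
apply: (mulIf P0); rewrite e -sum_nat_from2 // big_distrr /= -prodrXr -!big_split /=.
apply: eq_big_nat => i ik; have [_ lik] := andP ik.
have lis := leq_trans lik ks.
rewrite !natrB ?leq_pexp2l ?expn_gt0 ?(ltnW q1) // 1?ltnW // !natrX.
have D0 : q%:R ^+ (k - i) - 1 != 0 :> rat.
  by rewrite subr_eq0 -natrX pnatr_eq1 -(expn0 q) eqn_exp2l // subn_eq0 -ltnNge.
have -> : q%:R ^+ k - q%:R ^+ i = q%:R ^+ i * (q%:R ^+ (k - i) - 1) :> rat.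
  by rewrite mulrBr mulr1 -exprD subnKC // ltnW.
rewrite [X in _ = X](_ : _ = q%:R ^+ ((g - 1) * i) * q%:R ^+ i
    * (q%:R ^+ (g * (s - i)) - 1)); last first.
  by rewrite mulrACA mulfVK.
rewrite -exprD mulrBr mulr1 -exprD -!exprM; rewrite mulnBl mul1n subnK ?leq_pmull //.
by rewrite -mulnDr subnKC // ltnW.
Qed.

(** * The two families of designs *)

Theorem theorem14 (L : finFieldType) (K : {set L}) (q g s : nat) :
  (exists p e, [/\ prime p, (0 < e)%N & q = p ^ e]%N) ->
  (2 <= g)%N -> (3 <= s)%N ->
  is_subfield K -> #|K| = q -> #|L| = (q ^ g)%N ->
  (* (1) *)
  (forall k : nat, (3 <= k)%N -> (k <= s - 1)%N ->
     exists lam : nat,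
       (lam%:R : rat) =
         (q%:R ^+ ((g - 1) * ('C(k, 2) - 1)))%N *
         \prod_(2 <= i < k) ((q%:R ^+ (g * (s - i)) - 1) / (q%:R ^+ (k - i) - 1))
       /\ GDD K (g * s) g k lam (desarg_spread L s) (fatset s K k))
  /\
  (* (2) *)
  (#|SLorbits s K| = (q ^ g - 1) %/ (q - 1))%N /\
  (forall alpha : nat, (1 <= alpha)%N -> (alpha <= (q ^ g - 1) %/ (q - 1))%N ->
     forall O : {set {set {set 'rV[L]_s}}},
       O \subset SLorbits s K -> #|O| = alpha ->
       exists lam : nat,
         (lam%:R : rat) =
           alpha%:R * q%:R ^+ ((g - 1) * ('C(s, 2) - 1))%N *
           \prod_(2 <= i < s - 1) ((q%:R ^+ (g * i) - 1) / (q%:R ^+ i - 1))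
         /\ GDD K (g * s) g s lam (desarg_spread L s) (\bigcup_(X in O) X)).
Proof.
case=> p [e [pp e0 qE]] g2 s3 sK cK cL.
have [phi fixK] : exists phi : {rmorphism L -> L}, forall x, (x \in K) = (phi x == x).
  by apply: (subfield_fixed pp e0 sK); rewrite ?cK -?qE; [|exact: cL].
have g0 := ltnW g2.
have q1 : (1 < q)%N by rewrite qE -(exp1n e) ltn_exp2r // prime_gt1.
have fats k (M : 'M[L]_(2, s)) : (2 <= k)%N -> row_free M ->
    (#|[set U in fatset s K k | fixspan phi M \subset U]|
     * \prod_(2 <= i < k) (q ^ k - q ^ i)
     = \prod_(2 <= i < k) ((q ^ g) ^ s - (q ^ g) ^ i))%N.
  by move=> k2 fM; have := card_fat_supersets fixK cK (k - 2) fM; rewrite subnKC // cL.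
have prod_gt0 k : (0 < \prod_(2 <= i < k) (q ^ k - q ^ i))%N.
  rewrite big_seq prodn_cond_gt0 // => i; rewrite mem_index_iota => /andP[_ ik].
  by rewrite subn_gt0 ltn_exp2l.
(* A reference fat plane: lambda is taken to be the number of blocks above it. *)
have [M0 fM0] : exists M : 'M[L]_(2, s), row_free M.
  by exists (pid_mx 2); rewrite /row_free rank_pid_mx // ltnW.
have cSq : (#|SLorbits s K| * (q - 1) = q ^ g - 1)%N.
  case: s s3 {fats M0 fM0} => // s _.
  by have := card_SLorbits fixK s; rewrite cK cL -!subn1.
have cS : (#|SLorbits s K| = (q ^ g - 1) %/ (q - 1))%N.
  by rewrite -cSq mulnK // subn_gt0.
split; last split=> //.
  move=> k k3 ks; have k2 := ltnW k3.
  exists #|[set U in fatset s K k | fixspan phi M0 \subset U]|; split.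
    apply: fat_quotientE => //; last exact: fats.
    exact: leq_trans ks (leq_subr _ _).
  apply: (GDD_of_fat fixK cK cL) => [||M fM]; rewrite ?(ltnW s3) //.
  (* The counts above [M] and [M0] have the same product with a positive factor, so they agree. *)
  by apply/eqP; rewrite -(eqn_pmul2r (prod_gt0 k)) (fats _ _ k2 fM) (fats _ _ k2 fM0).
move=> alpha _ _ O sO cO; have s2 := ltnW s3.
exists #|[set U in \bigcup_(X in O) X | fixspan phi M0 \subset U]|.
have qg1 : (q - 1 <= q ^ g - 1)%N by rewrite leq_sub2r // -{1}(expn1 q) leq_pexp2l // ltnW.
have N0 : (0 < #|SLorbits s K|)%N by rewrite cS divn_gt0 ?subn_gt0.
have above (M : 'M[L]_(2, s)) : row_free M ->
  (#|[set U in \bigcup_(X in O) X | fixspan phi M \subset U]| * #|SLorbits s K|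
   = alpha * #|[set U in fatset s K s | fixspan phi M \subset U]|)%N.
  rewrite -cO; move: s3 O sO M {cS cSq N0 fats M0 fM0 s2 cO}.
  (* With [s] at least 3, a coordinate outside the plane remains for the dilation. *)
  case: s => [|[|[|n]]] // _ O sO M fM.
  exact: (card_SLorbits_above fixK fM sO).
have fatO : \bigcup_(X in O) X \subset fatset s K s.
  move: s3 O sO {cS cSq N0 fats M0 fM0 s2 cO above}.
  by case: s => // n _ O; apply: SLorbits_fat.
have NE : (#|SLorbits s K|)%:R = (q%:R ^+ g - 1) / (q%:R - 1) :> rat.
  have Dq : q%:R - 1 != 0 :> rat by rewrite subr_eq0 pnatr_eq1 gtn_eqF.
  apply: (mulIf Dq); rewrite divfK // -natrX -[1]/(1%:R) -!natrB ?expn_gt0 ?(ltnW q1) //.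
  by rewrite -natrM cSq.
split.
  have := fat_quotientE q1 g0 s2 (leqnn s) (fats _ _ s2 fM0).
  have NQ0 : (#|SLorbits s K|)%:R != 0 :> rat by rewrite pnatr_eq0 -lt0n.
  have := congr1 (fun m => m%:R : rat) (above _ fM0); rewrite !natrM => e1 e2.
  apply: (mulIf NQ0); rewrite e1 e2 -!mulrA; congr (_ * (_ * _)).
  (* Reversal turns [s - i] into [i.-1]. After a shift, the factor at 1 is the number of orbits and
     cancels, leaving the product from 2 to [s - 2]. *)
  rewrite big_nat_rev (eq_big_nat _ _ (F2 := fun i =>
    (q%:R ^+ (g * i.-1) - 1) / (q%:R ^+ i.-1 - 1))); last first.
    by case=> // i /andP[_ lis]; rewrite add2n !subSS subKn // ltnW // ltnW.
  rewrite big_add1 /= -subn1 big_ltn ?ltn_subRL // muln1 expr1 -NE.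
  by rewrite mulrC.
apply: (GDD_of_fat fixK cK cL) => [||M fM]; rewrite ?(ltnW s3) //.
apply/eqP; rewrite -(eqn_pmul2r N0) !above //.
apply/eqP; congr (_ * _)%N; apply/eqP.
by rewrite -(eqn_pmul2r (prod_gt0 s)) (fats _ _ s2 fM) (fats _ _ s2 fM0).
Qed.
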